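(* Let $n\geq 5$ be an integer and let $E(W_n)$ be the eccentricity matrix of the wheel graph $W_n$ on $n$ vertices. Then $$\det(E(W_n))=\begin{cases}2^{n-2}(1-n) & \text{if } n\not\equiv 1 \pmod 3,\\ 0 & \text{if } n\equiv 1 \pmod 3.\end{cases}$$
   Context: For a simple connected graph $G$ with vertices $v_1,\dots,v_n$, let $d(v_i,v_j)$ be the length of a shortest path between $v_i$ and $v_j$, and let $e(v_i)=\max\{d(v_i,v_j):1\le j\le n\}$ be the eccentricity of $v_i$. The eccentricity matrix $E(G)$ is the $n\times n$ real matrix with $(E(G))_{ij}=d(v_i,v_j)$ if $d(v_i,v_j)=\min\{e(v_i),e(v_j)\}$, and $(E(G))_{ij}=0$ otherwise. For $n\ge 4$, the wheel graph $W_n$ is the graph on $n$ vertices consisting of a cycle of length $n-1$ together with one further vertex (the hub) adjacent to every vertex of the cycle. The vertices are labelled so that $v_1$ is the hub and $v_2,\dots,v_n$ are the cycle vertices in cyclic order. *)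

(* Defs.v *)
From mathcomp Require Import all_boot all_order all_algebra.
From mathcomp Require Import reals.

Set Implicit Arguments.
Unset Strict Implicit.
Unset Printing Implicit Defensive.

Import GRing.Theory.

(* Graphs are adjacency relations on a finType; a simple graph is a symmetric
   and irreflexive one. *)
Section GraphDistance.
Variables (T : finType) (e : rel T).

Definition has_path_of_length (k : nat) (x y : T) : bool :=
  [exists p : k.-tuple T, [&& path e x p, uniq (x :: p) & last x p == y]].

(* A path has fewer than #|T| edges, so the search range misses none; the value
   is #|T| when no path joins x to y. *)
Definition gdist (x y : T) : nat :=
  find (fun k => has_path_of_length k x y) (iota 0 #|T|).

Definition eccentricity (x : T) : nat := \max_(y : T) gdist x y.

Lemma has_path_lt_card k (x y : T) : has_path_of_length k x y -> k < #|T|.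
Proof.
case/existsP=> p /and3P[_ uniq_p _].
have := max_card (mem (x :: p)).
by rewrite (card_uniqP uniq_p) /= size_tuple.
Qed.

Lemma gdistP (x y : T) : connect e x y ->
  has_path_of_length (gdist x y) x y /\
  (forall k, has_path_of_length k x y -> gdist x y <= k).
Proof.
case/connectP=> p0 /shortenP[p ep up _] ylast.
have pathp : has_path_of_length (size p) x y.
  by apply/existsP; exists (in_tuple p); rewrite /= ep -ylast eqxx andbT.
have ltp := has_path_lt_card pathp.
have hasp : has (fun k => has_path_of_length k x y) (iota 0 #|T|).
  by apply/hasP; exists (size p) => //; rewrite mem_iota.
split.
  have := nth_find 0 hasp; rewrite -/(gdist x y) nth_iota //.
  by have := hasp; rewrite has_find size_iota.
move=> k pathk; rewrite leqNgt; apply/negP => ltk.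
have := before_find 0 ltk.
by rewrite nth_iota ?(has_path_lt_card pathk) // add0n pathk.
Qed.

End GraphDistance.

Section EccentricityMatrix.
Local Open Scope ring_scope.

Definition eccentricity_mx (R : realType) (n : nat) (e : rel 'I_n) : 'M[R]_n :=
  \matrix_(i, j)
    if gdist e i j == minn (eccentricity e i) (eccentricity e j)
    then (gdist e i j)%:R else 0.

End EccentricityMatrix.

(* Vertex i of 'I_n is v_(i+1): 0 is the hub and 1, ..., n-1 is the cycle, with
   n-1 followed by 1. *)
Definition rim_succ (n i : nat) : nat := if i == n.-1 then 1 else i.+1.

Definition wheel (n : nat) : rel 'I_n := fun i j =>
  if val i == 0 then val j != 0
  else if val j == 0 then true
  else (val j == rim_succ n i) || (val i == rim_succ n j).

Lemma wheel_sym n : symmetric (@wheel n).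
Proof.
move=> i j; rewrite /wheel; case: (val i =P 0) => Hi; case: (val j =P 0) => Hj //=.
by rewrite orbC.
Qed.

Lemma wheel_irrefl n : 4 <= n -> irreflexive (@wheel n).
Proof.
move=> n_ge4 i; rewrite /wheel; case: eqP => //= _; rewrite orbb /rim_succ.
case: (val i =P n.-1) => [i_last|_]; last exact: ltn_eqF.
rewrite i_last; apply/negbTE; move: n_ge4; clear.
by case: n => [|[|[|]]].
Qed.

Lemma wheel_connected n (i j : 'I_n) : connect (@wheel n) i j.
Proof.
have n_gt0 : 0 < n by apply: leq_ltn_trans (ltn_ord i).
pose h := Ordinal n_gt0.
have toh k : connect (@wheel n) k h.
  case: (eqVneq k h) => [-> | nkh]; first exact: connect0.
  by apply: connect1; rewrite /wheel /=; case: eqP => // k0; rewrite -val_eqE /= k0 in nkh.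
apply: connect_trans (toh i) _.
by rewrite (sym_connect_sym (@wheel_sym n)) toh.
Qed.

(* Main.v *)
(* Let m = n - 1 and let S be the m x m cyclic shift. In block form E(W_n) is
   the matrix 2J - 2C, where C = 1 + S + S^-1, bordered by a row and a column of
   ones with corner 0. Subtracting multiples of the border removes 2J, and since
   all row sums of C are 3 the determinant becomes (m / 6) det(-2C).
   If 3 divides m, the m-periodic row vector (1, -1, 0, 1, -1, 0, ...) is
   annihilated by C. Otherwise S^3 is conjugate to S, so both have
   characteristic polynomial X^m - 1, and the factorization
   X^3 - S^3 = (X - S)(X^2 + X S + S^2) gives
   det(X^2 + X S + S^2) = (X^(3m) - 1) / (X^m - 1) = 1 + X^m + X^(2m);
   at X = 1 this is det(1 + S + S^2) = det(S C) = 3. *)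
Require Import Defs.
From mathcomp Require Import all_boot all_order all_algebra.
From mathcomp Require Import reals.
From mathcomp Require Import all_fingroup zify ring.

Set Implicit Arguments.
Unset Strict Implicit.
Unset Printing Implicit Defensive.

Import GRing.Theory.
Local Open Scope ring_scope.

(** * Cyclic shifts and their characteristic polynomials *)

Section CyclicShift.
Variable k : nat.

Definition shift_perm (c : 'I_k.+2) : 'S_k.+2 := perm (addIr c).

Lemma shift_permE c i : shift_perm c i = i + c.
Proof. by rewrite permE. Qed.

Lemma shift_permD a b : shift_perm (a + b) = (shift_perm a * shift_perm b)%g.
Proof. by apply/permP=> i; rewrite permM !shift_permE addrA. Qed.

Lemma shift_perm0 : shift_perm 0 = 1%g.
Proof. by apply/permP=> i; rewrite shift_permE perm1 addr0. Qed.

Lemma val_addr1 (i : 'I_k.+2) :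
  val (i + 1) = if i == k.+1 :> nat then 0%N else i.+1.
Proof.
rewrite /= [(1 %% _)%N]modn_small // addn1; case: eqP => [->|]; first by rewrite modnn.
by have := ltn_ord i; move=> *; rewrite modn_small //; lia.
Qed.

End CyclicShift.

Section ShiftMatrix.
Variables (R : comNzRingType) (k : nat).

Definition shift_mx (c : 'I_k.+2) : 'M[R]_k.+2 := perm_mx (shift_perm c).

Lemma shift_mxE c i j : shift_mx c i j = (j == i + c)%:R.
Proof. by rewrite !mxE shift_permE eq_sym. Qed.

Lemma shift_mxD a b : shift_mx (a + b) = shift_mx a *m shift_mx b.
Proof. by rewrite /shift_mx shift_permD perm_mxM. Qed.

Lemma shift_mx0 : shift_mx 0 = 1%:M.
Proof. by rewrite /shift_mx shift_perm0 perm_mx1. Qed.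

(** The shift by 1 is the companion matrix of ['X^(k.+2) - 1]. *)
Lemma char_poly_shift1 : char_poly (shift_mx 1) = 'X^(k.+2) - 1.
Proof.
have sz : (size ('X^(k.+2) - 1 : {poly R})).-1 = k.+2.
  by rewrite -[1]/(1%:P) size_XnsubC.
rewrite -[RHS]companionmxK; last exact: monicXnsubC.
(* The companion matrix has size [(size _).-1], equal to [k.+2] only propositionally; a variable [n]
   allows the equation to be substituted. *)
suff comp n (e : n = k.+2) (A : 'M[R]_n) :
    (forall i j, A i j = if (i == k.+1 :> nat) then (j == 0 :> nat)%:R
                         else (i.+1 == j :> nat)%:R) ->
    char_poly (shift_mx 1) = char_poly A.
  apply: (comp _ sz) => i j; rewrite mxE (_ : (size _).-1.-1 = k.+1) ?sz //.
  case: eqP => // _; rewrite coefB coefXn coef1.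
  have := ltn_ord j; rewrite [in X in (_ < X)%N -> _]sz => jlt.
  by rewrite (ltn_eqF jlt) sub0r opprK.
subst n => defA; congr char_poly; apply/matrixP=> i j.
rewrite shift_mxE defA -val_eqE val_addr1.
by case: ifP => _ //; rewrite eq_sym.
Qed.

Lemma char_poly_perm_mx_conj n (s t : 'S_n) :
  char_poly (perm_mx (t ^ s) : 'M[R]_n) = char_poly (perm_mx t).
Proof.
have conjE : char_poly_mx (perm_mx (t ^ s)) =
  perm_mx s^-1 *m char_poly_mx (perm_mx t : 'M[R]_n) *m perm_mx s.
  rewrite /char_poly_mx !map_perm_mx mulmxBr mulmxBl -!perm_mxM conjgE mulgA.
  by rewrite scalar_mxC -mulmxA -perm_mxM mulVg perm_mx1 mulmx1.
by rewrite /char_poly conjE !det_mulmx mulrAC -det_mulmx -perm_mxM mulVg perm_mx1 det1 mul1r.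
Qed.

(** Since [n] is a unit modulo [k.+2], multiplication by [n] permutes the indices and conjugates the
    shift by 1 into the shift by [n]. *)
Lemma char_poly_shift_coprime n : coprime k.+2 n ->
  char_poly (shift_mx n%:R) = 'X^(k.+2) - 1.
Proof.
move=> co; have u : (n%:R : 'I_k.+2) \is a GRing.unit.
  by rewrite (@unitZpE k.+2).
rewrite -char_poly_shift1 -[RHS](char_poly_perm_mx_conj (perm (mulIr u))).
congr (char_poly (perm_mx _)); apply/permP=> i.
set s := perm (mulIr u); rewrite -[i](permKV s); move: ((s^-1)%g i) => j.
by rewrite permJ !shift_permE !(permE (mulIr u)) mulrDl mul1r.
Qed.

End ShiftMatrix.

(** * The determinant of the matrix C *)

Lemma det_shift_trinomial (R : idomainType) k : coprime k.+2 3 ->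
  \det (1%:M + shift_mx R 1 + shift_mx R 2 : 'M_k.+2) = 3.
Proof.
move=> co; set m := k.+2.
pose P c : 'M[{poly R}]_m := map_mx polyC (shift_mx R c).
have PM a b : P a *m P b = P (a + b) by rewrite /P shift_mxD map_mxM.
pose Q := ('X^2)%:M + 'X%:M *m P 1 + P 2.
have factor : ('X%:M - P 1) *m Q = ('X^3)%:M - P 3.
  have P0 : P 0 = 1 by rewrite /P shift_mx0 map_mx1.
  have P1X n : P 1 ^+ n = P n%:R.
    elim: n => [|n IHn]; first by rewrite P0.
    by rewrite exprS IHn [_ * _]PM -natr1 addrC.
  rewrite -[P 3]/(P 3%:R) -P1X rmorphXn subrXX_comm; last exact: (esym (scalar_mxC 'X (P 1))).
  by rewrite !big_ord_recr big_ord0 /= add0r !P1X -!rmorphXn P0 mulr1 mul1r.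
(* This substitutes ['X^n] for ['X] in the characteristic polynomial of the shift by [c]. *)
have detX n (c : 'I_m) : char_poly (shift_mx R c) = 'X^m - 1 ->
    \det (('X^n)%:M - P c) = 'X^(n * m) - 1.
  move/(congr1 (comp_poly 'X^n)).
  rewrite comp_polyB comp_Xn_poly -exprM [in RHS]comp_polyC => <-.
  rewrite -det_map_mx; congr (\det _); rewrite map_mxB map_scalar_mx.
  rewrite -map_mx_comp /= comp_polyX; congr (_ - _).
  by apply/matrixP=> i j; rewrite !mxE /= comp_polyC.
have chi1 := char_poly_shift1 R k.
have chi3 : char_poly (shift_mx R 3) = 'X^m - 1 := char_poly_shift_coprime R co.
have nz : 'X^m - 1 != 0 :> {poly R} by rewrite monic_neq0 // monicXnsubC.
have := congr1 determinant factor.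
rewrite det_mulmx (detX 3 _ chi3) -['X]expr1 (detX 1%N _ chi1) mul1n mulnC exprM.
rewrite (subrX1 _ 3) !big_ord_recr big_ord0 /= add0r expr0 expr1 => /(mulfI nz).
move/(congr1 (horner_eval 1)); rewrite -det_map_mx => detQ.
transitivity (horner_eval 1 (1 + 'X^m + 'X^m ^+ 2) : R); last first.
  by rewrite /horner_eval !hornerE !expr1n -addrA.
have PE c : map_mx (horner_eval 1) (P c) = shift_mx R c.
  by apply/matrixP=> i j; rewrite !mxE /horner_eval hornerC.
rewrite -detQ; congr (\det _).
rewrite /Q !map_mxD map_mxM !map_scalar_mx !PE /= /horner_eval hornerXn hornerX.
by rewrite expr1n mul1mx.
Qed.

(** For [k >= 1] this is the identity plus the adjacency matrix of the cycle on [k.+2] vertices. *)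
Definition cycle_closed_adj (R : comNzRingType) k : 'M[R]_k.+2 :=
  1%:M + shift_mx R 1 + shift_mx R (- 1).

Lemma cycle_closed_adjE (R : comNzRingType) k i j : cycle_closed_adj R k i j =
  (j == i)%:R + (j == i + 1)%:R + (j == i - 1)%:R.
Proof.
by rewrite /cycle_closed_adj -{1}(shift_mx0 R k) 2!mxE !shift_mxE addr0.
Qed.

Lemma shift1_cycle_closed_adj (R : comNzRingType) k :
  shift_mx R 1 *m cycle_closed_adj R k = 1%:M + shift_mx R 1 + shift_mx R 2.
Proof.
rewrite /cycle_closed_adj !mulmxDr mulmx1 -!shift_mxD subrr shift_mx0.
by rewrite addrC addrA.
Qed.

(** Compare constant coefficients in the characteristic polynomial ['X^(k.+2) - 1]. *)
Lemma det_shift1 (R : comNzRingType) k : \det (shift_mx R 1 : 'M_k.+2) = (- 1) ^+ k.+1.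
Proof.
have := char_poly_det (shift_mx R (1 : 'I_k.+2)).
rewrite char_poly_shift1 coefB coefXn coef1 sub0r => /(congr1 ( *%R ((-1) ^+ k.+2))).
by rewrite mulrA -expr2 sqrr_sign mul1r mulrN1 exprS mulN1r opprK => <-.
Qed.

Lemma det_cycle_closed_adj (R : idomainType) k : coprime k.+2 3 ->
  \det (cycle_closed_adj R k) = (- 1) ^+ k.+1 * 3.
Proof.
move=> co; rewrite -(det_shift_trinomial R co) -shift1_cycle_closed_adj.
by rewrite det_mulmx det_shift1 mulrA -expr2 sqrr_sign mul1r.
Qed.

Lemma row_mul_shift (R : comNzRingType) k (v : 'rV[R]_k.+2) c j :
  (v *m shift_mx R c) 0 j = v 0 (j - c).
Proof.
rewrite mxE (bigD1 (j - c)) //= shift_mxE subrK eqxx mulr1 big1 ?addr0 // => i ne.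
by rewrite shift_mxE -subr_eq eq_sym (negPf ne) mulr0.
Qed.

Lemma det_cycle_closed_adj_eq0 (R : idomainType) k : (3 %| k.+2)%N ->
  \det (cycle_closed_adj R k) = 0.
Proof.
move=> dvd3; apply/eqP/det0P.
pose w (r : nat) : R := (r %% 3 == 0)%N%:R - (r %% 3 == 1)%N%:R.
(* As 3 divides [k.+2], the 3-periodic [w] does not see the wrap-around of the index. *)
have w_addr1 (i : 'I_k.+2) n : w (val (i + 1)%R + n)%N = w (i.+1 + n)%N.
  rewrite val_addr1; case: eqP => // ->.
  by rewrite /w -(modnDml k.+2) (eqP dvd3).
have w_sum r : w r + w r.+1 + w r.+2 = 0.
  rewrite /w -(addn2 r) -(addn1 r) -(modnDml r 1) -(modnDml r 2).
  have := ltn_pmod r (isT : (0 < 3)%N).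
  by case: (modn r 3) => [|[|[|]]] //= _; rewrite /modn /=; ring.
exists (\row_i w i).
  by apply/rV0Pn; exists 0; rewrite mxE /w mod0n subr0 oner_eq0.
apply/rowP=> j; rewrite !mulmxDr mulmx1 mxE [X in X + _]mxE !row_mul_shift opprK.
(* Recentring at [i = j - 1] turns the three entries into [w] at [i], [i + 1], [i + 2]. *)
rewrite -(subrK 1 j); move: (j - 1) => i; rewrite addrK !mxE.
have -> : w (val (i + 1)) = w i.+1 by have := w_addr1 i 0; rewrite !addn0.
have -> : w (val (i + 1 + 1)) = w i.+2.
  by have := w_addr1 (i + 1) 0; rewrite !addn0 => ->; rewrite -addn1 w_addr1 addn1.
by rewrite [X in X + _]addrC w_sum.
Qed.

(** * Determinants of matrices bordered by ones *)

(** Right multiplication by [U] replaces the border column by [- c] times itself plus all other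
    columns. This clears it below the corner, which becomes [m]. The factor [- c] is the determinant
    of [U]; keeping it on the left avoids a division. *)
Lemma det_bordered (R : comNzRingType) m (M : 'M[R]_m) c :
  M *m const_mx 1 = const_mx c :> 'cV_m ->
  \det (block_mx 0 (const_mx 1) (const_mx 1) M : 'M_(1 + m)) * - c =
    m%:R * \det M.
Proof.
move=> Mc.
pose U : 'M[R]_(1 + m) := block_mx (- c)%:M 0 (const_mx 1) 1%:M.
have <- : \det U = - c by rewrite det_lblock det1 mulr1 det_scalar1.
rewrite -det_mulmx mulmx_block !mul0mx !mulmx0 !add0r !mulmx1 Mc.
have -> : const_mx 1 *m (- c)%:M + const_mx c = 0 :> 'cV_m.
  by apply/matrixP=> i j; rewrite [j]ord1 !mxE big_ord1 !mxE mul1r addNr.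
rewrite det_ublock; congr (_ * _).
rewrite det_mx11 !mxE (eq_bigr (fun=> 1)) ?sumr_const ?card_ord // => i _.
by rewrite !mxE mulr1.
Qed.

(** Left multiplication by [L] adds [a] times the border row to every other row; the zero corner
    leaves the border column unchanged. *)
Lemma det_bordered_addl (R : comNzRingType) m (M : 'M[R]_m) a :
  \det (block_mx 0 (const_mx 1) (const_mx 1) (const_mx a + M) : 'M_(1 + m)) =
  \det (block_mx 0 (const_mx 1) (const_mx 1) M : 'M_(1 + m)).
Proof.
pose L : 'M[R]_(1 + m) := block_mx 1%:M 0 (const_mx a) 1%:M.
have detL : \det L = 1 by rewrite det_lblock !det1 mulr1.
rewrite -[RHS]mul1r -[X in X * _]detL.
rewrite -det_mulmx mulmx_block !mul0mx !mulmx0 !add0r !mul1mx !addr0.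
congr (\det (block_mx _ _ _ (_ + _))); apply/matrixP=> i j.
by rewrite !mxE big_ord1 !mxE mulr1.
Qed.

(** * Small distances in graphs *)

Section Distance.
Variables (T : finType) (e : rel T).

Lemma gdist_le_path x y p : path e x p -> uniq (x :: p) -> last x p = y ->
  (gdist e x y <= size p)%N.
Proof.
move=> ep up ly; have xy : connect e x y by apply/connectP; exists p.
have [_] := gdistP xy; apply; apply/existsP; exists (in_tuple p).
by rewrite /= ep ly eqxx andbT.
Qed.

Lemma gdist_refl x : gdist e x x = 0%N.
Proof. by apply/eqP; rewrite -leqn0 (@gdist_le_path x x [::]). Qed.

Lemma gdist_gt0 x y : connect e x y -> x != y -> (0 < gdist e x y)%N.
Proof.
case/gdistP=> xPy _; rewrite lt0n; apply: contraNneq => d0.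
by move: xPy; rewrite d0 => /existsP[p]; rewrite tuple0 => /and3P[].
Qed.

Lemma gdist_edge x y : x != y -> e x y -> gdist e x y = 1%N.
Proof.
move=> ne exy; apply/eqP; rewrite eqn_leq gdist_gt0 ?connect1 // andbT.
by apply: (@gdist_le_path x y [:: y]); rewrite //= ?exy ?inE ?ne.
Qed.

Lemma gdist_eq2 x z y : uniq [:: x; z; y] -> e x z -> e z y -> ~~ e x y ->
  gdist e x y = 2%N.
Proof.
move=> uxzy exz ezy nexy.
have xy : connect e x y by apply: connect_trans (connect1 ezy); apply: connect1.
have ne : x != y by case/and3P: uxzy; rewrite !inE negb_or => /andP[].
apply/eqP; rewrite eqn_leq; apply/andP; split.
  by apply: (@gdist_le_path x y [:: z; y]); rewrite //= exz ezy.
rewrite ltn_neqAle gdist_gt0 // andbT; apply: contra nexy => /eqP d1.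
have [] := gdistP xy; rewrite -d1 => /existsP[[[|a [|b s]] //= sz]].
by rewrite andbT => /and3P[exa _ /eqP <-].
Qed.

End Distance.

Lemma eq_addr_self (V : zmodType) (x c : V) : (x == x + c) = (c == 0).
Proof. by rewrite eq_sym -subr_eq0 addrC addKr. Qed.

(** * Distances and eccentricities in the wheel *)

Section Wheel.
Variable k : nat.
Hypothesis k_gt1 : (1 < k)%N.

(** Writing the order as [1 + k.+2] makes the hub and the rim the two index blocks of [block_mx],
    with rim indices in the cyclic group ['I_k.+2]. *)
Let dist : 'I_(1 + k.+2) -> 'I_(1 + k.+2) -> nat := gdist (@wheel (1 + k.+2)).
Let ecc : 'I_(1 + k.+2) -> nat := eccentricity (@wheel (1 + k.+2)).
Let hub : 'I_(1 + k.+2) := lshift k.+2 ord0.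
Let rim (i : 'I_k.+2) : 'I_(1 + k.+2) := rshift 1 i.
Let adj (i j : 'I_k.+2) := (j == i + 1) || (i == j + 1).

Lemma wheel_rim i j : wheel (rim i) (rim j) = adj i j.
Proof.
rewrite /wheel /rim_succ /= /adj -!val_eqE !val_addr1 !add1n !eqSS.
by do 2 case: ifP => _; rewrite ?eqSS.
Qed.

Lemma hub_neq_rim i : hub != rim i.
Proof. by rewrite -val_eqE. Qed.

Lemma dist_hub_rim i : dist hub (rim i) = 1%N.
Proof. by rewrite /dist gdist_edge ?hub_neq_rim. Qed.

Lemma dist_rim_hub i : dist (rim i) hub = 1%N.
Proof. by rewrite /dist gdist_edge // eq_sym hub_neq_rim. Qed.

Lemma dist_rim i j : dist (rim i) (rim j) =
  if i == j then 0%N else if adj i j then 1%N else 2%N.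
Proof.
rewrite /dist; case: eqVneq => [->|ne]; first exact: gdist_refl.
have ne' : rim i != rim j by rewrite (inj_eq (@rshift_inj _ _)).
case: ifP => aij; first by rewrite gdist_edge ?wheel_rim.
apply: (@gdist_eq2 _ _ _ hub); rewrite ?wheel_rim ?aij //.
by rewrite /= !inE eq_sym !(negPf (hub_neq_rim _)) (negPf ne').
Qed.

Lemma ecc_hub : ecc hub = 1%N.
Proof.
apply/eqP; rewrite eqn_leq; apply/andP; split.
  apply/bigmax_leqP=> y _; case: (split_ordP y) => i ->.
    by rewrite [i]ord1 gdist_refl.
  by rewrite -/(dist _ _) dist_hub_rim.
by rewrite -(dist_hub_rim 0) leq_bigmax.
Qed.

Lemma ord2_neq0 : 1 + 1 != 0 :> 'I_k.+2.
Proof. by rewrite -val_eqE /= !modn_small //; lia. Qed.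

(** This is where [1 < k] is sharp: on a rim of three vertices, all rim vertices are adjacent. *)
Lemma ord3_neq0 : 1 + 1 + 1 != 0 :> 'I_k.+2.
Proof. by rewrite -val_eqE /= !modn_small //; lia. Qed.

Lemma ecc_rim i : ecc (rim i) = 2%N.
Proof.
apply/eqP; rewrite eqn_leq; apply/andP; split.
  apply/bigmax_leqP=> y _; case: (split_ordP y) => j ->.
    by rewrite [j]ord1 -/hub -/(dist _ _) dist_rim_hub.
  by rewrite -/(dist _ _) dist_rim; case: ifP => _ //; case: ifP.
(* The vertex two steps along the rim is neither [i] nor a neighbour of [i], because 2 and 3 are
   nonzero and 2 differs from 1. *)
have far : dist (rim i) (rim (i + (1 + 1))) = 2%N.
  rewrite dist_rim /adj eq_addr_self (inj_eq (addrI i)) -!addrA eq_addr_self addrA.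
  by rewrite [1 + 1 == 1]eq_sym eq_addr_self (negPf ord2_neq0) (negPf ord3_neq0).
by rewrite -far leq_bigmax.
Qed.

(** Hub-rim distances equal the smaller eccentricity 1 and are kept. Between rim vertices the
    minimum is 2, so only distance 2 survives: the entry is 0 on closed neighbourhoods and 2
    elsewhere. *)
Lemma eccentricity_mx_wheel (R : realType) :
  eccentricity_mx R (@wheel (1 + k.+2)) =
  block_mx 0 (const_mx 1) (const_mx 1)
    (const_mx 2 - 2 *: cycle_closed_adj R k).
Proof.
apply/matrixP=> x y; rewrite mxE -/(dist x y) -/(ecc x) -/(ecc y).
case: (split_ordP x) => i ->; case: (split_ordP y) => j ->.
- by rewrite block_mxEul !ord1 -/hub ecc_hub /dist gdist_refl !mxE.
- by rewrite block_mxEur !ord1 -/hub -/(rim j) ecc_hub ecc_rim dist_hub_rim !mxE.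
- by rewrite block_mxEdl !ord1 -/hub -/(rim i) ecc_hub ecc_rim dist_rim_hub !mxE.
rewrite block_mxEdr -/(rim i) -/(rim j) !ecc_rim dist_rim.
rewrite mxE [in RHS]mxE [X in _ + X]mxE [X in _ - X]mxE cycle_closed_adjE /adj [j == i - 1]eq_sym subr_eq.
case: (eqVneq i j) => [<-|_].
  rewrite eq_addr_self oner_eq0 /=.
  by rewrite !addr0 mulr1 subrr.
case: (eqVneq j (i + 1)) => [->|_].
  (* Since 2 is nonzero, the two rim neighbours of a vertex are distinct and this entry of C is 1,
     not 2. *)
  rewrite -addrA eq_addr_self (negPf ord2_neq0) /=.
  by rewrite addr0 add0r mulr1 subrr.
by case: (i == j + 1); rewrite /= ?addr0 ?add0r ?mulr1 ?mulr0 ?subrr ?subr0.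
Qed.

End Wheel.

Theorem theorem3p4 (R : realType) (n : nat) (n_ge5 : (5 <= n)%N) :
  \det (eccentricity_mx R (@wheel n)) =
    if (n != 1 %[mod 3])%N then 2 ^+ (n - 2) * (1 - n%:R) else 0.
Proof.
case: n n_ge5 => [|[|[|k]]] // k_gt1.
set C := cycle_closed_adj R k.
(* C is a sum of three permutation matrices, so its row sums are 3. *)
have rowsum : (- 2 *: C) *m const_mx 1 = const_mx (- 6) :> 'cV_k.+2.
  have perm_sum c : shift_mx R c *m const_mx 1 = const_mx 1 :> 'cV_k.+2.
    rewrite -row_permE; apply/matrixP=> i j.
    by rewrite !mxE.
  rewrite -scalemxAl !mulmxDl mul1mx !perm_sum.
  by apply/matrixP=> i j; rewrite !mxE; ring.
(* The factor 6 is the [- c] of [det_bordered] for the row sum [c = - 6]. *)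
apply: (@mulIf _ 6); first by rewrite Num.Theory.pnatr_eq0.
rewrite eccentricity_mx_wheel // det_bordered_addl -scaleNr.
rewrite -[6 in LHS]opprK (det_bordered rowsum) detZ.
rewrite eqn_mod_dvd // subn1 /=; case: ifPn => [ndvd3|].
  have co : coprime k.+2 3 by rewrite coprime_sym prime_coprime.
  rewrite det_cycle_closed_adj // (exprNn 2) subSS subSS subn0 -[k.+3]addn1 natrD.
  (* One sign comes from scaling by -2 in dimension [k.+2], the other from the determinant of C. *)
  have sign2 : (- 1) ^+ k.+2 * (- 1) ^+ k.+1 = - 1 :> R.
    by rewrite exprS -mulrA -expr2 sqrr_sign mulr1.
  transitivity (k.+2%:R * (2 ^+ k.+2 * ((- 1) ^+ k.+2 * (- 1) ^+ k.+1) * 3) : R).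
    by ring.
  rewrite sign2 [2 ^+ k.+2]exprS; move: (k.+2%:R) (2 ^+ k.+1) => a b; ring.
by rewrite negbK => dvd3; rewrite det_cycle_closed_adj_eq0 // !mulr0 mul0r.
Qed.
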